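(* Let $\beta>1/2$, $m>0$, and let $X$ be a random variable with density $h_{\beta,m}(x)=C_{\beta,m}\,x^{-2\beta}e^{-m/x}$, $x\in(0,\infty)$. Then for every smooth $\phi:(0,\infty)\to\mathbb R$ such that $\phi(X)$ has finite variance, $$\mathrm{Var}[\phi(X)]\le \frac{1}{\rho(\beta)}\,E\big\{X^2[\phi'(X)]^2\big\},\qquad \rho(\beta)=\begin{cases}(\beta-\tfrac12)^2, & \tfrac12<\beta\le\tfrac32,\\ 2(\beta-1), & \beta>\tfrac32.\end{cases}$$
   Context: $C_{\beta,m}>0$ is the normalizing constant making $h_{\beta,m}$ a probability density on $(0,\infty)$. $\mathrm{Var}[\phi(X)]=E[\phi(X)^2]-(E[\phi(X)])^2$. *)

(* Defs.v *)
From HB Require Import structures.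
From mathcomp Require Import all_boot all_order all_algebra.
From mathcomp Require Import all_classical all_reals all_analysis.
Set Implicit Arguments. Unset Strict Implicit. Unset Printing Implicit Defensive.
Import Order.TTheory GRing.Theory Num.Theory.
Import numFieldNormedType.Exports.
Local Open Scope classical_set_scope.
Local Open Scope ring_scope.

Section Defs.
Variable R : realType.

Definition pos_half : set R := `]0, +oo[%classic.

Definition hdens_un (beta m : R) (x : R) : R :=
  x `^ (- (2 * beta)) * expR (- (m / x)).

Definition Cnorm (beta m : R) : R :=
  (Rintegral lebesgue_measure pos_half (hdens_un beta m))^-1.

Definition hdens (beta m : R) (x : R) : R := Cnorm beta m * hdens_un beta m x.

Definition Expect (beta m : R) (g : R -> R) : \bar R :=
  (\int[lebesgue_measure]_(x in pos_half) (g x * hdens beta m x)%:E)%E.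

(* Var[phi(X)] = E[phi(X)^2] - (E[phi(X)])^2 (real-valued; meaningful when finite) *)
Definition Variance (beta m : R) (phi : R -> R) : R :=
  fine (Expect beta m (fun x => phi x ^+ 2)) - (fine (Expect beta m phi)) ^+ 2.

Definition smooth_on_pos (phi : R -> R) : Prop :=
  forall (n : nat) (x : R), 0 < x -> derivable (iter n (@derive1 R R) phi) x 1.

Definition rho (beta : R) : R :=
  if beta <= 3 / 2 then (beta - 1 / 2) ^+ 2 else 2 * (beta - 1).

End Defs.

(* Main.v *)
Require Import Defs.
From HB Require Import structures.
From mathcomp Require Import all_boot all_order all_algebra.
From mathcomp Require Import all_classical all_reals all_analysis.
From mathcomp Require Import measurable_realfun ring lra.
Set Implicit Arguments.
Unset Strict Implicit.
Unset Printing Implicit Defensive.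
Import Order.TTheory GRing.Theory Num.Theory.
Import numFieldNormedType.Exports.
Local Open Scope classical_set_scope.
Local Open Scope ring_scope.

(** Let [h] be the density, [0 < gamma <= 1] and [k := 2 beta - 1 - gamma > 0],
    and put [c := m / k], [F x := x^gamma - c^gamma].  Then
    [(x^2 h F')' = - h g] with [g x = k F' x (x - c)], and [g / F >= gamma k]
    away from [c] because [gamma <= 1].  For [psi := phi - phi c], completing
    the square gives the Riccati-type inequality
      [(x^2 h F' psi^2 / F)' <= x^2 h phi'^2 - gamma k h psi^2].
    Integrating it on both sides of [c], the boundary terms at [0] and [+oo]
    have the favourable sign and those at [c] vanish since [psi c = 0]; hence
    [gamma k E(psi^2) <= E(X^2 phi'^2)], while [Var phi <= E(psi^2)].  The
    choice [gamma := min(1, beta - 1/2)] makes [gamma k = rho beta]. *)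

(** * Differential inequalities integrated over a segment *)

Lemma is_derive_continuous (R : realType) (f : R -> R) (x df : R) :
  is_derive x 1 f df -> {for x, continuous f}.
Proof.
by move=> [+ _] => /derivable1_diffP/differentiable_continuous.
Qed.

Lemma within_itv_continuous (R : realType) (f : R -> R) (a b : R) :
  (forall x, a <= x <= b -> {for x, continuous f}) ->
  {within `[a, b], continuous f}.
Proof.
move=> cf; apply: continuous_in_subspaceT => x.
by rewrite inE /= in_itv /=; exact: cf.
Qed.

(** The fundamental theorem of calculus gives [G b - G a] as the integral of [dG]. No integral is
    subtracted in the conclusion, so that it can pass to a limit in which the integral of [p]
    becomes infinite. *)
Lemma integral_le_of_derive_le (R : realType) (G dG p q : R -> R) (a b : R) :
  a < b ->
  (forall x, a <= x <= b -> is_derive x 1 G (dG x)) ->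
  (forall x, a <= x <= b -> {for x, continuous dG}) ->
  (forall x, a <= x <= b -> {for x, continuous p}) ->
  (forall x, a <= x <= b -> {for x, continuous q}) ->
  (forall x, a <= x <= b -> dG x <= p x - q x) ->
  (\int[lebesgue_measure]_(x in `[a, b]) (q x)%:E <=
   \int[lebesgue_measure]_(x in `[a, b]) (p x)%:E + (G a - G b)%:E)%E.
Proof.
move=> ab G1 cdG cp cq le_dG.
have int f : (forall x, a <= x <= b -> {for x, continuous f}) ->
    lebesgue_measure.-integrable `[a, b] (EFin \o f).
  move=> cf; apply: continuous_compact_integrable; first exact: segment_compact.
  exact: within_itv_continuous.
have FTC : (\int[lebesgue_measure]_(x in `[a, b]) (dG x)%:E =
    (G b)%:E - (G a)%:E)%E.
  have cG x : a <= x <= b -> {for x, continuous G}.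
    by move=> /G1/is_derive_continuous.
  apply: continuous_FTC2 => //.
  - exact: within_itv_continuous.
  - split.
    + move=> x; rewrite in_itv /= => /andP[ax xb].
      by have [] : is_derive x 1 G (dG x) by apply: G1; rewrite !ltW.
    + by apply: cvg_at_right_filter; apply: cG; rewrite lexx ltW.
    + by apply: cvg_at_left_filter; apply: cG; rewrite lexx ltW.
  - move=> x; rewrite in_itv /= => /andP[ax xb]; rewrite derive1E.
    by have [] : is_derive x 1 G (dG x) by apply: G1; rewrite !ltW.
have finI f : (forall x, a <= x <= b -> {for x, continuous f}) ->
    (\int[lebesgue_measure]_(x in `[a, b]) (f x)%:E)%E \is a fin_num.
  by move=> /int/integrable_fin_num; apply.
(* With the boundary term written as minus the integral of [dG], it remains to compare the
   integrands [q + dG] and [p] pointwise. *)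
have -> : (G a - G b)%:E =
    (- \int[lebesgue_measure]_(x in `[a, b]) (dG x)%:E)%E.
  by rewrite FTC -EFinB -EFinN opprB.
rewrite leeBrDr ?finI// -integralD//; [|exact: int..].
apply: le_integral => //; [|exact: int|].
- by apply: integrableD => //; exact: int.
- move=> x; rewrite inE /= in_itv /= => abx.
  by rewrite -EFinD lee_fin addrC -lerBrDr; exact: le_dG.
Qed.

(** For [G = sigma f psi^2 / F], the integrand on the right minus the one on the left minus [G'] is
    a completed square weighted by [sigma] plus [(g / F - lam) psi^2 h], both nonnegative. [F] may
    have either sign, so the lemma serves on both sides of a zero of [F]. *)
Lemma weighted_hardy_segment (R : realType)
    (sigma h f F g psi dpsi : R -> R) (lam a b : R) :
  a < b ->
  (forall x, a <= x <= b ->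
     [/\ is_derive x 1 F (f x),
         is_derive x 1 (fun y => sigma y * f y) (- (h x * g x)) &
         is_derive x 1 psi (dpsi x)]) ->
  (forall x, a <= x <= b ->
     [/\ {for x, continuous sigma}, {for x, continuous h},
         {for x, continuous f}, {for x, continuous g} &
         {for x, continuous dpsi}]) ->
  (forall x, a <= x <= b ->
     [/\ F x != 0, 0 <= sigma x, 0 <= h x & lam <= g x / F x]) ->
  (\int[lebesgue_measure]_(x in `[a, b]) (lam * (psi x ^+ 2 * h x))%:E <=
   \int[lebesgue_measure]_(x in `[a, b]) (sigma x * dpsi x ^+ 2)%:E +
   (sigma a * f a * psi a ^+ 2 / F a - sigma b * f b * psi b ^+ 2 / F b)%:E)%E.
Proof.
move=> ab dr ct ineq; pose G x := sigma x * f x * psi x ^+ 2 / F x.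
pose dG x := (- (h x * g x)) * psi x ^+ 2 / F x
  + sigma x * f x * (2 * psi x * dpsi x) / F x
  - sigma x * f x * psi x ^+ 2 * (f x * (F x)^-1 ^+ 2).
have cF x : a <= x <= b -> {for x, continuous F}.
  by move=> /dr[/is_derive_continuous].
have cpsi x : a <= x <= b -> {for x, continuous psi}.
  by move=> /dr[_ _ /is_derive_continuous].
apply: (@integral_le_of_derive_le _ G dG) => //.
- move=> x xab; have [dF ds dp] := dr _ xab; have [F0 _ _ _] := ineq _ xab.
  have dV := is_deriveV F0 dF.
  have d2 : is_derive x 1 (fun y => psi y ^+ 2) (2 * psi x * dpsi x).
    by apply: (is_derive_eq (is_deriveX 2 dp)); rewrite /= expr1.
  have dM := is_deriveM (is_deriveM ds d2) dV.
  apply: (is_derive_eq dM); rewrite /dG.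
  (* The derivative rules give their result with scalings [*:]; this convertible form with products
     is one that [field] can treat. *)
  rewrite -[LHS]/((sigma x * f x * psi x ^+ 2) * (- (F x)^-2 * f x)
    + (F x)^-1 * (sigma x * f x * (2 * psi x * dpsi x)
                 + psi x ^+ 2 * (- (h x * g x)))).
  by field.
- move=> x xab; have [cs ch cf cg cd] := ct _ xab.
  have [F0 _ _ _] := ineq _ xab.
  have cFV : {for x, continuous (fun y => (F y)^-1)}.
    by apply: continuousV => //; exact: cF.
  have cP := cpsi _ xab.
  rewrite /dG; apply: cvgB; [apply: cvgD|].
  + apply: cvgM => //; apply: cvgM; [|apply: cvgM => //].
    by apply: cvgN; exact: cvgM.
  + apply: cvgM => //; apply: cvgM; [exact: cvgM|].
    by apply: cvgM => //; apply: cvgM => //; exact: cvg_cst.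
  + apply: cvgM; [apply: cvgM; [exact: cvgM|exact: cvgM]|].
    by apply: cvgM => //; exact: cvgM.
- move=> x xab; have [cs _ _ _ cd] := ct _ xab.
  by apply: cvgM => //; exact: cvgM.
- move=> x xab; have [_ ch _ _ _] := ct _ xab; have cP := cpsi _ xab.
  by apply: cvgM; [exact: cvg_cst|apply: cvgM => //; exact: cvgM].
- move=> x xab; have [F0 s0 h0 lamg] := ineq _ xab.
  (* The left-out difference [p - q - dG] of the two integrands and the derivative is exactly the
     sum of the two quantities in [sq] and [hp]. *)
  have sq : 0 <= sigma x * (dpsi x - f x * psi x / F x) ^+ 2.
    by rewrite mulr_ge0 // sqr_ge0.
  have hp : 0 <= (g x / F x - lam) * (psi x ^+ 2 * h x).
    by rewrite mulr_ge0 ?subr_ge0// mulr_ge0// sqr_ge0.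
  rewrite -subr_ge0; apply: le_trans (addr_ge0 sq hp) _.
  by rewrite le_eqVlt; apply/orP; left; apply/eqP; rewrite /dG; field.
Qed.

(** * Limits along exhausting sets and of boundary terms *)

(** Monotone convergence applies to both nonnegative integrands. The errors and their limit are
    finite, so the right-hand side converges even when the integral of [p] is infinite. *)
Lemma ge0_le_integral_bigcup (R : realType) (A : (set R)^nat) (e : R^nat)
    (p q : R -> R) :
  nondecreasing_seq A -> (forall n, measurable (A n)) ->
  measurable_fun (\bigcup_n A n) p -> measurable_fun (\bigcup_n A n) q ->
  (forall x, (\bigcup_n A n) x -> 0 <= p x) ->
  (forall x, (\bigcup_n A n) x -> 0 <= q x) ->
  e @ \oo --> 0 ->
  (forall n, \int[lebesgue_measure]_(x in A n) (q x)%:E <=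
     \int[lebesgue_measure]_(x in A n) (p x)%:E + (e n)%:E)%E ->
  (\int[lebesgue_measure]_(x in \bigcup_n A n) (q x)%:E <=
   \int[lebesgue_measure]_(x in \bigcup_n A n) (p x)%:E)%E.
Proof.
move=> ndA mA mp mq p0 q0 e0 le_qp.
have mU : measurable (\bigcup_n A n) by exact: bigcup_measurable.
have cvgA (f : R -> R) : measurable_fun (\bigcup_n A n) f ->
    (forall x, (\bigcup_n A n) x -> 0 <= f x) ->
    (\int[lebesgue_measure]_(x in A n) (f x)%:E @[n --> \oo] -->
     \int[lebesgue_measure]_(x in \bigcup_n A n) (f x)%:E)%E.
  move=> mf f0; apply: ge0_nondecreasing_set_cvg_integral => //.
  - move=> n; apply/measurable_EFinP; apply: measurable_funS mf => //.
    exact: bigcup_sup.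
  - by move=> n x Anx; rewrite lee_fin f0//; exists n.
have cvgp : (\int[lebesgue_measure]_(x in A n) (p x)%:E + (e n)%:E
    @[n --> \oo] --> \int[lebesgue_measure]_(x in \bigcup_n A n) (p x)%:E)%E.
  rewrite -[X in _ --> X]adde0; apply: cvgeD; [|exact: cvgA|].
  - by rewrite fin_num_adde_defl.
  - by apply: cvg_EFin => //; exact: nearW.
by apply: lee_cvg_to (cvgA _ mq q0) cvgp _; exact: nearW.
Qed.

Lemma is_derive_cvgn (R : realType) (f : R -> R) (x df : R) (u : R^nat) :
  is_derive x 1 f df -> (forall n, u n != x) -> u @ \oo --> x ->
  (f (u n) - f x) / (u n - x) @[n --> \oo] --> df.
Proof.
move=> [der <-] ux cu.
have := (cvgr_dnbhsP _ _ _).1 der (fun n => u n - x).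
have -> : (fun n : nat => (f (u n) - f x) / (u n - x)) =
   (fun n : nat => (u n - x)^-1 *: ((f \o shift x) ((u n - x) *: 1) - f x)).
  apply/funext => n /=.
  by rewrite /GRing.scale /= mulr1 subrK mulrC.
apply; split; first by move=> n; rewrite subr_eq0.
by rewrite -(subrr x); apply: cvgB => //; exact: cvg_cst.
Qed.

(** A double zero beats a simple one: [psi^2 / F] is [psi] times the ratio of the difference
    quotients of [psi] and [F] at [x]; the first factor tends to [0] and the ratio to
    [dpsi / dF]. *)
Lemma sqr_div_cvgn0 (R : realType) (s F psi : R -> R) (x dF dpsi : R)
    (u : R^nat) :
  {for x, continuous s} -> is_derive x 1 F dF -> is_derive x 1 psi dpsi ->
  dF != 0 -> F x = 0 -> psi x = 0 ->
  (forall n, u n != x) -> u @ \oo --> x ->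
  s (u n) * psi (u n) ^+ 2 / F (u n) @[n --> \oo] --> 0.
Proof.
move=> cs DF Dpsi dF0 F0 psi0 ux cu.
have QF := is_derive_cvgn DF ux cu.
have Qp := is_derive_cvgn Dpsi ux cu.
have cpsi := is_derive_continuous Dpsi.
have -> : (fun n : nat => s (u n) * psi (u n) ^+ 2 / F (u n)) =
    (fun n : nat => s (u n) * psi (u n) * ((psi (u n) - psi x) / (u n - x))
      * ((F (u n) - F x) / (u n - x))^-1).
  apply/funext => n; rewrite psi0 F0 !subr0 invfM invrK.
  have unx : u n - x != 0 by rewrite subr_eq0.
  (* [F (u n)] is not known to be nonzero, so its inverse is made opaque; [field] then needs only
     [u n - x != 0]. *)
  by set v := (F (u n))^-1; field.
have -> : (0 : R) = s x * psi x * dpsi * dF^-1 by rewrite psi0 mulr0 !mul0r.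
apply: cvgM; last exact: cvgV.
apply: cvgM => //; apply: cvgM.
- exact: (cvg_comp _ _ cu cs).
- exact: (cvg_comp _ _ cu cpsi).
Qed.

(** * Pointwise facts on the density and on powers *)

Lemma is_derive_hdens_un (R : realType) (beta m x : R) : 0 < x ->
  is_derive x 1 (hdens_un beta m)
    ((m / x ^+ 2 - 2 * beta / x) * hdens_un beta m x).
Proof.
move=> x0; have xN0 : x != 0 by rewrite gt_eqF.
have d1 := is_derive1_powR (- (2 * beta)) x0.
have dV : is_derive x 1 (fun y : R => - (m / y)) (m / x ^+ 2).
  have := is_deriveV xN0 (is_derive_id x 1) => d.
  apply: (is_derive_eq (is_deriveN (is_deriveZ m d))).
  rewrite -[LHS]/(- (m * (- x ^- 2 * 1))).
  by field.
have d2 := @is_derive1_comp _ expR (fun y => - (m / y)) x _ _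
  (is_derive_expR (- (m / x))) dV.
apply: (is_derive_eq (is_deriveM d1 d2)).
rewrite -[LHS]/(x `^ (- (2 * beta)) * (expR (- (m / x)) * (m / x ^+ 2))
  + expR (- (m / x)) * (- (2 * beta) * x `^ (- (2 * beta) - 1))).
rewrite /hdens_un powRB ?xN0 ?implybT// powRr1 ?ltW//.
set A := powR _ _; set B := expR _; by field.
Qed.

(** Since [x^gamma = x^(gamma - 1) x], the bound reduces to comparing [x^(gamma - 1)] with
    [x0^(gamma - 1)], and this power is nonincreasing because [gamma <= 1]. For [x < x0] the
    denominator is negative and the inequality flips when it is cleared. This is the source of
    [g / F >= gamma k]. *)
Lemma powR_sub_bound (R : realType) (gamma x0 x : R) :
  0 < gamma -> gamma <= 1 -> 0 < x0 -> 0 < x -> x != x0 ->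
  1 <= x `^ (gamma - 1) * (x - x0) / (x `^ gamma - x0 `^ gamma).
Proof.
move=> g0 g1 x00 xp xx0.
have powE y : 0 < y -> y `^ gamma = y `^ (gamma - 1) * y.
  move=> y0; have := @powRD _ y (gamma - 1) 1.
  by rewrite subrK powRr1 ?ltW// (gt_eqF y0) implybT; apply.
have anti y z : 0 < y -> y <= z -> z `^ (gamma - 1) <= y `^ (gamma - 1).
  move=> y0 yz; have z0 : 0 < z by exact: lt_le_trans yz.
  rewrite -[gamma - 1]opprB !powRN lef_pV2 ?posrE ?powR_gt0//.
  by apply: ge0_ler_powR => //; rewrite ?subr_ge0// nnegrE ltW.
have mono y z : 0 < y -> y < z -> y `^ gamma < z `^ gamma.
  move=> y0 yz; have z0 : 0 < z by exact: lt_trans yz.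
  by apply: gt0_ltr_powR => //; rewrite nnegrE ltW.
have [xlt|xgt|/eqP] := ltgtP x x0; last by rewrite (negbTE xx0).
- rewrite ler_ndivlMr ?subr_lt0 ?mono// mul1r !powE// mulrBr lerB//.
  by apply: ler_wpM2r; [exact: ltW|apply: anti => //; exact: ltW].
- rewrite ler_pdivlMr ?subr_gt0 ?mono// mul1r !powE// mulrBr lerB//.
  by apply: ler_wpM2r; [exact: ltW|apply: anti => //; exact: ltW].
Qed.

(** * Exhaustion of the two sides of [c] by segments *)

(** The shift by 3 keeps every segment nondegenerate, here and to the left of [c], where [n.+2]
    would give the single point [c / 2] at [n = 0]. *)
Lemma bigcup_itv_right (R : realType) (c : R) : 0 < c ->
  \bigcup_n `[c + c / n.+3%:R, c + c * n.+3%:R]%classic = `]c, +oo[%classic.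
Proof.
move=> c0; apply/seteqP; split => x /=.
- move=> [n _] /=; rewrite !in_itv /= andbT => /andP[+ _].
  by apply: lt_le_trans; rewrite ltrDl divr_gt0.
- rewrite in_itv /= andbT => cx; have d0 : 0 < x - c by rewrite subr_gt0.
  (* Each endpoint asks the index to exceed one ratio; an integer above the sum of the two ratios
     serves both. *)
  have r0 : 0 < c / (x - c) by rewrite divr_gt0.
  have r1 : 0 < (x - c) / c by rewrite divr_gt0.
  have := archi_boundP (ltW (addr_gt0 r0 r1)); set n := Num.bound _ => nP.
  have nn3 : (n%:R : R) <= n.+3%:R by rewrite ler_nat; do 3 apply/leqW.
  exists n => //=; rewrite in_itv /=; apply/andP; split.
  + rewrite -lerBrDl ler_pdivrMr ?ltr0Sn// mulrC -ler_pdivrMr//.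
    by apply: le_trans nn3; apply/ltW; apply: lt_trans nP; rewrite ltrDl.
  + rewrite -lerBlDl mulrC -ler_pdivrMr//.
    by apply: le_trans nn3; apply/ltW; apply: lt_trans nP; rewrite ltrDr.
Qed.

Lemma bigcup_itv_left (R : realType) (c : R) : 0 < c ->
  \bigcup_n `[c / n.+3%:R, c - c / n.+3%:R]%classic = `]0, c[%classic.
Proof.
move=> c0; apply/seteqP; split => x /=.
- move=> [n _] /=; rewrite !in_itv /= => /andP[xl xr]; apply/andP; split.
  + by apply: lt_le_trans xl; rewrite divr_gt0.
  + by apply: le_lt_trans xr _; rewrite ltrBlDr ltrDl divr_gt0.
- rewrite in_itv /= => /andP[x0 xc]; have d0 : 0 < c - x by rewrite subr_gt0.
  have r0 : 0 < c / (c - x) by rewrite divr_gt0.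
  have r1 : 0 < c / x by rewrite divr_gt0.
  have := archi_boundP (ltW (addr_gt0 r0 r1)); set n := Num.bound _ => nP.
  have nn3 : (n%:R : R) <= n.+3%:R by rewrite ler_nat; do 3 apply/leqW.
  exists n => //=; rewrite in_itv /=; apply/andP; split.
  + rewrite ler_pdivrMr ?ltr0Sn// mulrC -ler_pdivrMr//.
    by apply: le_trans nn3; apply/ltW; apply: lt_trans nP; rewrite ltrDr.
  + rewrite lerBrDr -lerBrDl ler_pdivrMr ?ltr0Sn// mulrC -ler_pdivrMr//.
    by apply: le_trans nn3; apply/ltW; apply: lt_trans nP; rewrite ltrDl.
Qed.

Lemma cvgn_div_natS3 (R : realType) (c : R) : c / n.+3%:R @[n --> \oo] --> 0.
Proof.
rewrite -(mulr0 c); apply: cvgM; first exact: cvg_cst.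
(* [harmonic] is [1 / (n + 1)], so a shift by 2 gives the denominators [n + 3]. *)
have := @cvg_harmonic R; rewrite -(cvg_shiftn 2).
by under eq_fun do rewrite /harmonic addn2.
Qed.

Lemma ler_div_natS3 (R : realType) (c : R) (n k : nat) :
  0 < c -> (n <= k)%N -> c / k.+3%:R <= c / n.+3%:R.
Proof.
by move=> c0 nk; rewrite ler_pM2l// lef_pV2 ?posrE ?ltr0Sn// ler_nat !ltnS.
Qed.

(** * The weighted inequality for the unnormalized density *)

Lemma hdens_un_gt0 (R : realType) (beta m x : R) : 0 < x ->
  0 < hdens_un beta m x.
Proof. by move=> x0; rewrite mulr_gt0 ?powR_gt0 ?expR_gt0. Qed.

Lemma pos_half_measurable_fun (R : realType) (f : R -> R) (A : set R) :
  measurable A -> A `<=` @pos_half R ->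
  (forall x : R, 0 < x -> {for x, continuous f}) -> measurable_fun A f.
Proof.
move=> mA Apos cf.
apply: (@measurable_funS _ _ _ _ (@pos_half R)) => //.
  exact: measurable_itv.
apply: open_continuous_measurable_fun; first exact: interval_open.
by move=> x; rewrite inE /pos_half /= in_itv /= andbT; exact: cf.
Qed.

(** The relation between [c] and [m] makes [g] vanish at [c], so that [g] changes sign together with
    [F] and [g / F] stays positive on both sides. Both integrals are extended reals and may be
    infinite. *)
Lemma hdens_un_hardy (R : realType) (beta m gamma c : R) (phi dphi : R -> R) :
  0 < gamma -> gamma <= 1 -> 0 < c -> (2 * beta - 1 - gamma) * c = m ->
  0 < m ->
  (forall x : R, 0 < x -> is_derive x 1 phi (dphi x)) ->
  (forall x : R, 0 < x -> {for x, continuous dphi}) ->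
  (\int[lebesgue_measure]_(x in @pos_half R)
     (gamma * (2 * beta - 1 - gamma) *
       ((phi x - phi c) ^+ 2 * hdens_un beta m x))%:E <=
   \int[lebesgue_measure]_(x in @pos_half R)
     (x ^+ 2 * hdens_un beta m x * dphi x ^+ 2)%:E)%E.
Proof.
move=> g0 g1 c0 cE m0 dP cdP.
set k := 2 * beta - 1 - gamma in cE *.
have k0 : 0 < k by rewrite -(pmulr_lgt0 _ c0) cE.
pose h := hdens_un beta m.
pose sigma x := x ^+ 2 * h x.
pose f x := gamma * x `^ (gamma - 1).
pose F x := x `^ gamma - c `^ gamma.
pose g x := f x * (k * (x - c)).
pose psi x := phi x - phi c.
pose G x := sigma x * f x * psi x ^+ 2 / F x.
pose lam := gamma * k.
pose p x := sigma x * dphi x ^+ 2.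
pose q x := lam * (psi x ^+ 2 * h x).
have dh (x : R) : 0 < x -> is_derive x 1 h ((m / x ^+ 2 - 2 * beta / x) * h x).
  exact: is_derive_hdens_un.
have dF (x : R) : 0 < x -> is_derive x 1 F (f x).
  move=> x0; apply: (is_derive_eq (is_deriveB (is_derive1_powR gamma x0)
    (is_derive_cst (c `^ gamma) x 1))).
  by rewrite subr0.
have df (x : R) : 0 < x -> is_derive x 1 f ((gamma - 1) / x * f x).
  move=> x0; have xN0 : x != 0 by rewrite gt_eqF.
  apply: (is_derive_eq (is_deriveZ gamma (is_derive1_powR (gamma - 1) x0))).
  rewrite -[LHS]/(gamma * ((gamma - 1) * x `^ (gamma - 1 - 1))).
  rewrite powRB ?xN0 ?implybT// powRr1 ?ltW// /f.
  by set A := powR _ _; field.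
have dsigma (x : R) : 0 < x ->
    is_derive x 1 sigma ((2 * x + m - 2 * beta * x) * h x).
  move=> x0; have xN0 : x != 0 by rewrite gt_eqF.
  have d2 := is_deriveX 2 (is_derive_id x 1).
  apply: (is_derive_eq (is_deriveM d2 (dh _ x0))).
  rewrite -[LHS]/(x ^+ 2 * ((m / x ^+ 2 - 2 * beta / x) * h x)
     + h x * (2%:R * x ^+ 1 * 1)).
  by set A := h x; field.
(* The product rule gives [h f ((gamma + 1 - 2 beta) x + m)], which is [h f k (c - x)] because
   [m = k c]. *)
have dsf (x : R) : 0 < x -> is_derive x 1 (fun y => sigma y * f y) (- (h x * g x)).
  move=> x0; have xN0 : x != 0 by rewrite gt_eqF.
  apply: (is_derive_eq (is_deriveM (dsigma _ x0) (df _ x0))).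
  rewrite -[LHS]/(sigma x * ((gamma - 1) / x * f x)
    + f x * ((2 * x + m - 2 * beta * x) * h x)).
  rewrite /g /sigma -cE /k; set A := h x; set B := f x.
  by field.
have dpsi (x : R) : 0 < x -> is_derive x 1 psi (dphi x).
  move=> x0; apply: (is_derive_eq (is_deriveB (dP _ x0)
    (is_derive_cst (phi c) x 1))).
  by rewrite subr0.
have ch (x : R) : 0 < x -> {for x, continuous h}.
  by move=> /dh/is_derive_continuous.
have csigma (x : R) : 0 < x -> {for x, continuous sigma}.
  by move=> /dsigma/is_derive_continuous.
have cf (x : R) : 0 < x -> {for x, continuous f}.
  by move=> /df/is_derive_continuous.
have cpsi (x : R) : 0 < x -> {for x, continuous psi}.
  by move=> /dpsi/is_derive_continuous.
have cg (x : R) : 0 < x -> {for x, continuous g}.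
  move=> x0; apply: cvgM; first exact: cf.
  apply: cvgM; first exact: cvg_cst.
  by apply: cvgB; [exact: cvg_id|exact: cvg_cst].
have cp (x : R) : 0 < x -> {for x, continuous p}.
  by move=> x0; apply: cvgM; [exact: csigma|apply: cvgM; exact: cdP].
have cq (x : R) : 0 < x -> {for x, continuous q}.
  move=> x0; apply: cvgM; first exact: cvg_cst.
  by apply: cvgM; [apply: cvgM; exact: cpsi|exact: ch].
have h0 (x : R) : 0 < x -> 0 < h x by exact: hdens_un_gt0.
have f0 (x : R) : 0 < x -> 0 < f x by move=> x0; rewrite mulr_gt0 ?powR_gt0.
have sigma0 (x : R) : 0 < x -> 0 < sigma x.
  by move=> x0; rewrite mulr_gt0 ?exprn_gt0 ?h0.
have p0 (x : R) : 0 < x -> 0 <= p x.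
  by move=> x0; rewrite mulr_ge0 ?sqr_ge0// ltW ?sigma0.
have q0 (x : R) : 0 < x -> 0 <= q x.
  move=> x0; apply: mulr_ge0; first by rewrite ltW ?mulr_gt0.
  by rewrite mulr_ge0 ?sqr_ge0// ltW ?h0.
have FlN (x : R) : 0 < x -> x < c -> F x < 0.
  by move=> x0 xc; rewrite subr_lt0 gt0_ltr_powR// nnegrE ltW.
have FrP (x : R) : c < x -> 0 < F x.
  move=> cx; rewrite subr_gt0 gt0_ltr_powR// nnegrE ltW//.
  exact: lt_trans cx.
have G0 (x : R) : 0 < x -> 0 <= sigma x * f x * psi x ^+ 2.
  move=> x0; rewrite mulr_ge0 ?sqr_ge0//.
  by rewrite ltW// mulr_gt0 ?f0 ?sigma0.
(* Segments stay strictly on one side of [c], the only zero of [F] on the half-line. *)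
have seg a b : 0 < a -> a < b -> b < c \/ c < a ->
  (\int[lebesgue_measure]_(x in `[a, b]) (q x)%:E <=
   \int[lebesgue_measure]_(x in `[a, b]) (p x)%:E + (G a - G b)%:E)%E.
  move=> a0 ab bca.
  have pos (x : R) : a <= x <= b -> 0 < x by move=> /andP[/(lt_le_trans a0)].
  have neqc (x : R) : a <= x <= b -> x != c.
    move=> /andP[ax xb]; case: bca => [bc|ca].
    - by rewrite lt_eqF// (le_lt_trans xb).
    - by rewrite gt_eqF// (lt_le_trans ca).
  apply: (@weighted_hardy_segment _ sigma h f F g psi dphi) => // x xab.
  - by split; [exact: dF (pos _ xab)|exact: dsf (pos _ xab)|
               exact: dpsi (pos _ xab)].
  - by split; [exact: csigma (pos _ xab)|exact: ch (pos _ xab)|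
      exact: cf (pos _ xab)|exact: cg (pos _ xab)|exact: cdP (pos _ xab)].
  - have x0 := pos _ xab; have xc := neqc _ xab.
    split; [|exact: ltW (sigma0 _ x0)|exact: ltW (h0 _ x0)|].
    + by case: (ltgtP x c) xc => // [/FlN-/(_ x0)/lt_eqF->|/FrP/gt_eqF->].
    + have := powR_sub_bound g0 g1 c0 x0 xc.
      rewrite -(ler_pM2l (mulr_gt0 g0 k0)) mulr1 => /le_trans; apply.
      by rewrite /g /f le_eqVlt; apply/orP; left; apply/eqP; ring.
(* The singularity of [G] at [c] is removable: [psi c = 0], and the zero of [F] is simple because
   [f c > 0]. *)
have cG (u : R^nat) : (forall n, u n != c) -> u @ \oo --> c ->
    G (u n) @[n --> \oo] --> 0.
  move=> uc cu.
  apply: (@sqr_div_cvgn0 _ (fun y => sigma y * f y) F psi c (f c) (dphi c)).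
  - exact: is_derive_continuous (dsf _ c0).
  - exact: dF.
  - exact: dpsi.
  - by rewrite gt_eqF ?f0.
  - by rewrite /F subrr.
  - by rewrite /psi subrr.
  - exact: uc.
  - exact: cu.
have d0 n : 0 < c / n.+3%:R by rewrite divr_gt0.
have dlt n : c / n.+3%:R < c / 2.
  by rewrite ltr_pM2l// ltf_pV2 ?posrE// ltr_nat.
have right : (\int[lebesgue_measure]_(x in `]c, +oo[) (q x)%:E <=
   \int[lebesgue_measure]_(x in `]c, +oo[) (p x)%:E)%E.
  have sub : `]c, +oo[%classic `<=` @pos_half R.
    move=> x; rewrite /pos_half /= !in_itv /= !andbT; exact: lt_trans.
  have pos (x : R) : `]c, +oo[%classic x -> 0 < x.
    by move=> /sub; rewrite /pos_half /= in_itv /= andbT.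
  rewrite -bigcup_itv_right//.
  apply: (@ge0_le_integral_bigcup _ _ (fun n => G (c + c / n.+3%:R))).
  - move=> n k' nk; apply/subsetPset => x /=.
    rewrite !in_itv /= => /andP[xl xr].
    apply/andP; split.
      by apply: le_trans xl; rewrite lerD2l ler_div_natS3.
    by apply: le_trans xr _; rewrite lerD2l ler_pM2l// ler_nat.
  - by move=> n; exact: measurable_itv.
  - by rewrite bigcup_itv_right//; exact: pos_half_measurable_fun.
  - by rewrite bigcup_itv_right//; exact: pos_half_measurable_fun.
  - by rewrite bigcup_itv_right// => x /pos/p0.
  - by rewrite bigcup_itv_right// => x /pos/q0.
  - apply: cG => [n|]; first by rewrite gt_eqF// ltrDl.
    rewrite -[X in _ --> X]addr0; apply: cvgD; first exact: cvg_cst.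
    exact: cvgn_div_natS3.
  - move=> n; have ca : c < c + c / n.+3%:R by rewrite ltrDl.
    have ab : c + c / n.+3%:R < c + c * n.+3%:R.
      rewrite ltrD2l ltr_pM2l//; apply: (@lt_trans _ _ 1).
        by rewrite invf_lt1// ltr1n.
      by rewrite ltr1n.
    (* To the right of [c], [F > 0] makes [G] nonnegative at the far end, so that term is dropped;
       the term near [c] is the vanishing error. *)
    apply: le_trans (seg _ _ _ ab _) _; [exact: lt_trans ca|by right|].
    rewrite leeD2l// lee_fin gerBl; apply: divr_ge0.
      exact/G0/(lt_trans c0)/(lt_trans ca).
    exact/ltW/FrP/(lt_trans ca).
have left : (\int[lebesgue_measure]_(x in `]0%R, c[) (q x)%:E <=
   \int[lebesgue_measure]_(x in `]0%R, c[) (p x)%:E)%E.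
  have sub : `]0, c[%classic `<=` @pos_half R.
    by move=> x; rewrite /pos_half /= !in_itv /= andbT => /andP[].
  have pos (x : R) : `]0, c[%classic x -> 0 < x.
    by move=> /sub; rewrite /pos_half /= in_itv /= andbT.
  rewrite -bigcup_itv_left//.
  apply: (@ge0_le_integral_bigcup _ _ (fun n => - G (c - c / n.+3%:R))).
  - move=> n k' nk; apply/subsetPset => x /=.
    rewrite !in_itv /= => /andP[xl xr].
    apply/andP; split; first by apply: le_trans xl; rewrite ler_div_natS3.
    by apply: le_trans xr _; rewrite lerD2l lerN2 ler_div_natS3.
  - by move=> n; exact: measurable_itv.
  - by rewrite bigcup_itv_left//; exact: pos_half_measurable_fun.
  - by rewrite bigcup_itv_left//; exact: pos_half_measurable_fun.
  - by rewrite bigcup_itv_left// => x /pos/p0.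
  - by rewrite bigcup_itv_left// => x /pos/q0.
  - rewrite -oppr0; apply: cvgN; apply: cG => [n|].
      by rewrite lt_eqF// ltrBlDr ltrDl.
    rewrite -[X in _ --> X]subr0; apply: cvgB; first exact: cvg_cst.
    exact: cvgn_div_natS3.
  - move=> n; have bc : c - c / n.+3%:R < c by rewrite ltrBlDr ltrDl.
    have ab : c / n.+3%:R < c - c / n.+3%:R.
      by move: (dlt n); set d := c / n.+3%:R; lra.
    (* To the left of [c], [F < 0] makes [G] nonpositive at the end near [0], so this time the left
       endpoint is dropped. *)
    apply: le_trans (seg _ _ _ ab _) _; [exact: d0|by left|].
    rewrite leeD2l// lee_fin gerDr mulr_ge0_le0 ?G0// invr_le0.
    by apply/ltW/FlN => //; exact: lt_trans bc.
have posE : @pos_half R = `]0, c[%classic `|` `[c, +oo[%classic.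
  by rewrite /pos_half (@itv_bndbnd_setU _ _ _ (BLeft c)) // bnd_simp.
have cpos : `[c, +oo[%classic `<=` @pos_half R.
  by rewrite posE; exact: subsetUr.
have split_int (r : R -> R) : (forall x : R, 0 < x -> {for x, continuous r}) ->
    (forall x : R, 0 < x -> 0 <= r x) ->
    (\int[lebesgue_measure]_(x in @pos_half R) (r x)%:E =
     \int[lebesgue_measure]_(x in `]0%R, c[) (r x)%:E +
     \int[lebesgue_measure]_(x in `]c, +oo[) (r x)%:E)%E.
  (* The point [c] is null, so it may be added to the right piece, which turns the two pieces into a
     partition of the half-line. *)
  move=> cr r0; rewrite integral_itv_obnd_cbnd; last first.
    apply/measurable_EFinP; apply: pos_half_measurable_fun => //.
    by move=> x; rewrite /pos_half /= !in_itv /= !andbT; exact: lt_trans.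
  rewrite posE ge0_integral_setU//.
  - rewrite -posE; apply/measurable_EFinP; apply: pos_half_measurable_fun => //.
    exact: measurable_itv.
  - by move=> x; rewrite -posE /pos_half /= in_itv /= andbT lee_fin; exact: r0.
  - apply/disj_setPS => x [] /=; rewrite !in_itv /= andbT => /andP[_ xc] cx.
    by move: (lt_le_trans xc cx); rewrite ltxx.
change (\int[lebesgue_measure]_(x in @pos_half R) (q x)%:E <=
   \int[lebesgue_measure]_(x in @pos_half R) (p x)%:E)%E.
by rewrite !split_int//; exact: leeD.
Qed.

(** * Normalization and the variance *)

Lemma Cnorm_ge0 (R : realType) (beta m : R) : 0 <= Cnorm beta m.
Proof.
rewrite invr_ge0; apply: Rintegral_ge0 => x.
by rewrite /pos_half /= in_itv /= andbT => /(hdens_un_gt0 beta m)/ltW.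
Qed.

(** [fine] sends an infinite integral to [0], whose inverse is [0] by convention; a nonzero [Cnorm]
    therefore certifies convergence. *)
Lemma Cnorm_neq0_integrable (R : realType) (beta m : R) : Cnorm beta m != 0 ->
  lebesgue_measure.-integrable (@pos_half R) (EFin \o hdens_un beta m).
Proof.
move=> C0; have mU : measurable_fun (@pos_half R) (hdens_un beta m).
  apply: pos_half_measurable_fun => //; first exact: measurable_itv.
  by move=> x /(is_derive_hdens_un beta m)/is_derive_continuous.
have mp : measurable (@pos_half R) by exact: measurable_itv.
apply/integrableP; split; first exact/measurable_EFinP.
rewrite (@integral_fin_num_abs _ _ _ lebesgue_measure _ (hdens_un beta m))//.
move: C0; rewrite /Cnorm /Rintegral invr_eq0.
by case: (\int[_]_(x in _) _)%E => //=; rewrite eqxx.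
Qed.

(** As [C0] makes the total mass [1], expanding the square shows that the two sides differ by the
    square of [E phi - c]. *)
Lemma Variance_le_centered (R : realType) (beta m c : R) (phi : R -> R) :
  Cnorm beta m != 0 -> (forall x : R, 0 < x -> {for x, continuous phi}) ->
  lebesgue_measure.-integrable (@pos_half R)
    (fun x => (phi x ^+ 2 * hdens beta m x)%:E) ->
  ((Variance beta m phi)%:E <= Expect beta m (fun x => (phi x - c) ^+ 2)%R)%E.
Proof.
move=> C0 cphi i2.
have mp : measurable (@pos_half R) by exact: measurable_itv.
have Cge0 := Cnorm_ge0 beta m.
have intZ (k : R) (f : R -> R) :
    lebesgue_measure.-integrable (@pos_half R) (EFin \o f) ->
    lebesgue_measure.-integrable (@pos_half R) (EFin \o (fun x => k * f x)).
  by move=> fi; apply: eq_integrable (integrableZl _ k fi).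
have intD (f g : R -> R) :
    lebesgue_measure.-integrable (@pos_half R) (EFin \o f) ->
    lebesgue_measure.-integrable (@pos_half R) (EFin \o g) ->
    lebesgue_measure.-integrable (@pos_half R) (EFin \o (fun x => f x + g x)).
  by move=> fi gi; apply: eq_integrable (integrableD _ fi gi).
have iU := Cnorm_neq0_integrable C0.
set h := hdens beta m in i2 *.
have ih : lebesgue_measure.-integrable (@pos_half R) (EFin \o h).
  exact: (intZ _ _ iU).
have mh : measurable_fun (@pos_half R) h.
  by apply/measurable_EFinP; case/integrableP: ih.
have mphi : measurable_fun (@pos_half R) phi by exact: pos_half_measurable_fun.
have h0 x : pos_half x -> 0 <= h x.
  rewrite /pos_half /= in_itv /= andbT => x0.
  by rewrite mulr_ge0 // ltW ?hdens_un_gt0.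
(* The first moment is finite by domination: [|t| <= 1 + t^2] bounds [|phi| h] by [h + phi^2 h]. *)
have i1 : lebesgue_measure.-integrable (@pos_half R)
    (EFin \o (fun x => phi x * h x)).
  apply: le_integrable (intD _ _ ih i2) => //.
    by apply/measurable_EFinP; exact: measurable_funM.
  move=> x px /=; rewrite !lee_fin normrM (ger0_norm (h0 _ px)).
  rewrite [leRHS]ger0_norm; last first.
    by rewrite addr_ge0 ?h0// mulr_ge0 ?sqr_ge0 ?h0.
  rewrite -[X in X + _]mul1r -mulrDl ler_wpM2r ?h0//.
  by rewrite ler_norml; apply/andP; split; nra.
have hE : (\int[lebesgue_measure]_(x in @pos_half R) h x)%R = 1.
  by rewrite /h /hdens RintegralZl// mulVf// -invr_eq0.
have iZ1 : lebesgue_measure.-integrable (@pos_half R)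
    (EFin \o (fun x => - (2 * c) * (phi x * h x))).
  exact: (intZ _ _ i1).
have iZ2 : lebesgue_measure.-integrable (@pos_half R)
    (EFin \o (fun x => c ^+ 2 * h x)).
  exact: (intZ _ _ ih).
have cE : Expect beta m (fun x => (phi x - c) ^+ 2)%R =
    (\int[lebesgue_measure]_(x in @pos_half R)
      (phi x ^+ 2 * h x + ((- (2 * c)) * (phi x * h x) + c ^+ 2 * h x)))%R%:E.
  have iM : lebesgue_measure.-integrable (@pos_half R) (EFin \o (fun x =>
      phi x ^+ 2 * h x + ((- (2 * c)) * (phi x * h x) + c ^+ 2 * h x))).
    exact: (intD _ _ i2 (intD _ _ iZ1 iZ2)).
  rewrite /Rintegral fineK; last exact: integrable_fin_num.
  by apply: eq_integral => x _ /=; congr EFin; rewrite -/h; ring.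
rewrite cE lee_fin.
rewrite RintegralD//; last first.
  exact: (intD _ _ iZ1 iZ2).
rewrite RintegralD// RintegralZl// RintegralZl// hE /Variance /Expect.
rewrite -/(Rintegral lebesgue_measure (@pos_half R)
  (fun x => phi x ^+ 2 * h x)).
rewrite -/(Rintegral lebesgue_measure (@pos_half R) (fun x => phi x * h x)).
set S := Rintegral _ _ _; set M := Rintegral _ _ _.
by rewrite -subr_ge0; have := sqr_ge0 (M - c); nra.
Qed.

(** The unnormalized inequality is multiplied by the nonnegative constant [Cnorm / lam]. *)
Lemma Expect_hardy (R : realType) (beta m gamma c : R) (phi dphi : R -> R) :
  0 < gamma -> gamma <= 1 -> 0 < c -> (2 * beta - 1 - gamma) * c = m ->
  0 < m ->
  (forall x : R, 0 < x -> is_derive x 1 phi (dphi x)) ->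
  (forall x : R, 0 < x -> {for x, continuous dphi}) ->
  (Expect beta m (fun x => (phi x - phi c) ^+ 2)%R <=
   (gamma * (2 * beta - 1 - gamma))^-1%:E *
   Expect beta m (fun x => x ^+ 2 * dphi x ^+ 2)%R)%E.
Proof.
move=> g0 g1 c0 cE m0 dP cdP.
have := hdens_un_hardy g0 g1 c0 cE m0 dP cdP.
set lam := gamma * _ => H.
have lam0 : 0 < lam by rewrite mulr_gt0// -(pmulr_lgt0 _ c0) cE.
have mp : measurable (@pos_half R) by exact: measurable_itv.
have Cge0 := Cnorm_ge0 beta m.
have cU (x : R) : 0 < x -> {for x, continuous (hdens_un beta m)}.
  by move=> /(is_derive_hdens_un beta m)/is_derive_continuous.
have U0 (x : R) : pos_half x -> 0 <= hdens_un beta m x.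
  by rewrite /pos_half /= in_itv /= andbT => /(hdens_un_gt0 beta m)/ltW.
have cphi (x : R) : 0 < x -> {for x, continuous phi}.
  by move=> /dP/is_derive_continuous.
(* Nonnegativity lets the constant leave the integral even when the latter is infinite. *)
have ZE (k : R) (r : R -> R) : 0 <= k ->
    (forall x : R, 0 < x -> {for x, continuous r}) ->
    (forall x : R, pos_half x -> 0 <= r x) ->
    (\int[lebesgue_measure]_(x in @pos_half R) (k * r x)%:E =
     k%:E * \int[lebesgue_measure]_(x in @pos_half R) (r x)%:E)%E.
  move=> k0 cr r0; under eq_integral do rewrite EFinM.
  rewrite ge0_integralZl//.
  by apply/measurable_EFinP; exact: pos_half_measurable_fun.
have -> : Expect beta m (fun x => (phi x - phi c) ^+ 2)%R =
  ((lam^-1 * Cnorm beta m)%:E * \int[lebesgue_measure]_(x in @pos_half R)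
     (lam * ((phi x - phi c) ^+ 2 * hdens_un beta m x))%:E)%E.
  rewrite -ZE.
  - apply: eq_integral => x _; congr EFin; rewrite /hdens.
    by field; rewrite gt_eqF.
  - by rewrite mulr_ge0// invr_ge0 ltW.
  - move=> x x0; apply: cvgM; first exact: cvg_cst.
    apply: cvgM; last exact: cU.
    by apply: cvgM; apply: cvgB; [exact: cphi|exact: cvg_cst|exact: cphi|
      exact: cvg_cst].
  - move=> x px; apply: mulr_ge0; first exact: ltW.
    by rewrite mulr_ge0 ?sqr_ge0 ?U0.
have -> : Expect beta m (fun x => x ^+ 2 * dphi x ^+ 2)%R =
  ((Cnorm beta m)%:E * \int[lebesgue_measure]_(x in @pos_half R)
     (x ^+ 2 * hdens_un beta m x * dphi x ^+ 2)%:E)%E.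
  rewrite -ZE//.
  - by apply: eq_integral => x _; congr EFin; rewrite /hdens; ring.
  - move=> x x0; apply: cvgM; last by apply: cvgM; exact: cdP.
    by apply: cvgM; [apply: cvgM; exact: cvg_id|exact: cU].
  - by move=> x px; rewrite mulr_ge0 ?sqr_ge0// mulr_ge0 ?sqr_ge0 ?U0.
rewrite muleA -EFinM; apply: lee_wpmul2l => //.
by rewrite lee_fin mulr_ge0// invr_ge0 ltW.
Qed.

(** * Choice of the exponent that produces [rho] *)

Theorem theorem2p3 (R : realType) (beta m : R) (phi : R -> R) :
  1 / 2 < beta -> 0 < m ->
  smooth_on_pos phi ->
  lebesgue_measure.-integrable (@pos_half R)
    (fun x => (phi x ^+ 2 * hdens beta m x)%:E) ->
  ((Variance beta m phi)%:E <=
     ((rho beta)^-1)%:E * Expect beta m (fun x => (x ^+ 2 * (derive1 phi x) ^+ 2)%R))%E.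
Proof.
move=> hb m0 sm i2.
(* A divergent normalizing integral would give the junk value [Cnorm = 0], for
   which both sides vanish; so its convergence need not be proved. *)
have [C0|C0] := eqVneq (Cnorm beta m) 0.
  have E0 f : Expect beta m f = 0%E.
    rewrite /Expect; apply: integral0_eq => x _.
    by rewrite /hdens C0 mul0r mulr0.
  by rewrite /Variance !E0 /= mule0 expr0n subrr.
have dP (x : R) : 0 < x -> is_derive x 1 phi (derive1 phi x).
  by move=> x0; rewrite derive1E; apply: derivableP; exact: (sm 0%N).
have cdP (x : R) : 0 < x -> {for x, continuous (derive1 phi)}.
  by move=> /(sm 1%N)/derivable1_diffP/differentiable_continuous.
(* The product [gamma (2 beta - 1 - gamma)] is largest at [gamma = beta - 1/2]; for [beta > 3/2] the
   constraint [gamma <= 1] binds and [gamma = 1] is taken. *)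
have [gamma [g0 g1 gb ->]] : exists gamma : R, [/\ 0 < gamma, gamma <= 1,
    0 < 2 * beta - 1 - gamma & rho beta = gamma * (2 * beta - 1 - gamma)].
  rewrite /rho; case: (lerP beta (3 / 2)) => b32.
  - by exists (beta - 1 / 2); split; [lra|lra|lra|field].
  - by exists 1; split; [lra|lra|lra|ring].
(* This quotient is the point [c] at which [F] and [g] vanish; the variance is then compared with
   the second moment about [phi c]. *)
have c0 : 0 < m / (2 * beta - 1 - gamma) by rewrite divr_gt0.
apply: le_trans (Expect_hardy g0 g1 c0 _ m0 dP cdP); last first.
  by rewrite mulrC divfK// gt_eqF.
by apply: Variance_le_centered => // x /dP/is_derive_continuous.
Qed.
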